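(* Let $D$ be a deck of $n\ge 1$ cards whose values lie in a finite totally ordered set (the order is arbitrary and does not affect the result), and for each value $v$ occurring in $D$ let $n_v$ be the number of cards of $D$ with value $v$. Let $D'$ be a reordering of $D$, and let $N$ be the number of distinct reorderings of $D$. Then, as $a\to\infty$ through positive integers, $$\mathbb{P}_a(D\to D') = \frac1N + c_1(D,D')\,a^{-1} + O(a^{-2}),$$ where $$c_1(D,D') = \frac{n}{2N}\sum_{u<v}\frac{W(D,u,v)\,Z(D',u,v)}{n_u n_v},$$ the sum being over pairs $u<v$ of values occurring in $D$.
   Context: A deck of $n$ cards is a function $D$ from $\{1,\dots,n\}$ to a set of values; $D(i)$ is the value of the card in position $i$ (position 1 is the top). Values may repeat. A permutation $\pi\in S_n$ acts on decks by moving the card in position $i$ to position $\pi(i)$, i.e. $\pi D = D'$ iff $D'(\pi(i))=D(i)$ for all $i$. A reordering of $D$ is a deck of the form $\pi D$, $\pi\in S_n$. $T(D,D')=\{\pi\in S_n : \pi D=D'\}$. For a positive integer $a$, the $a$-shuffle distribution on $S_n$ is $\mathbb{P}_a(\pi)=\frac1{a^n}\binom{a+n-\operatorname{des}(\pi)-1}{n}$, where $\operatorname{des}(\pi)=\#\{1\le i\le n-1:\pi(i)>\pi(i+1)\}$. The transition probability is $\mathbb{P}_a(D\to D')=\sum_{\pi\in T(D,D')}\mathbb{P}_a(\pi)$. A $u$-$v$ digraph in $D$ is an index $i$ with $D(i)=u$, $D(i+1)=v$. A $u$-$v$ pair in $D$ is a pair $(i,j)$ with $i<j$, $D(i)=u$,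 $D(j)=v$. Define $W(D,u,v)=\#\{u\text{-}v\text{ digraphs in }D\}-\#\{v\text{-}u\text{ digraphs in }D\}$ and $Z(D,u,v)=\#\{u\text{-}v\text{ pairs in }D\}-\#\{v\text{-}u\text{ pairs in }D\}$. *)

(* Defs.v *)
From mathcomp Require Import all_boot all_order all_algebra all_fingroup.
From mathcomp Require Import all_classical all_reals all_analysis.

Set Implicit Arguments.
Unset Strict Implicit.
Unset Printing Implicit Defensive.

Import Order.TTheory GRing.Theory Num.Theory.
Import numFieldNormedType.Exports.

Local Open Scope ring_scope.

(* Positions are 0-based: the top card is in position 0. *)
Definition deck (V : finType) (n : nat) := {ffun 'I_n -> V}.

Section Decks.
Variables (V : finType) (n : nat).
Implicit Types (D : deck V n) (pi : 'S_n) (u v : V).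

Definition permute pi D : deck V n := [ffun j => D ((pi^-1)%g j)].

Lemma permuteP pi D D' :
  permute pi D = D' <-> (forall i, D' (pi i) = D i).
Proof.
split=> [<- i|eqD]; first by rewrite ffunE permK.
by apply/ffunP=> j; rewrite ffunE -eqD permKV.
Qed.

Definition reorderings D : {set deck V n} := [set permute pi D | pi : 'S_n].

Definition transitions D D' : {set 'S_n} := [set pi | permute pi D == D'].

Definition mult D v : nat := #|[set i | D i == v]|.

Definition digraphs D u v : {set 'I_n} :=
  [set i : 'I_n | (D i == u) &&
    [exists j : 'I_n, (val j == (val i).+1) && (D j == v)]].

Definition pairs D u v : {set 'I_n * 'I_n} :=
  [set p : 'I_n * 'I_n | [&& (p.1 < p.2)%N, D p.1 == u & D p.2 == v]].

Definition W D u v : int := #|digraphs D u v|%:Z - #|digraphs D v u|%:Z.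

Definition Z D u v : int := #|pairs D u v|%:Z - #|pairs D v u|%:Z.

End Decks.

Definition des (n : nat) (pi : 'S_n) : nat :=
  #|[set i : 'I_n | [exists j : 'I_n,
      (val j == (val i).+1) && (pi j < pi i)%N]]|.

(* The natural-number subtraction does not truncate when 0 < a and 0 < n,
   since then des pi <= n - 1. *)
Definition shuffle_prob (R : realType) (n a : nat) (pi : 'S_n) : R :=
  'C(a + n - des pi - 1, n)%:R / a%:R ^+ n.

Definition trans_prob (R : realType) (V : finType) (n a : nat)
    (D D' : deck V n) : R :=
  \sum_(pi in transitions D D') shuffle_prob R a pi.

Definition c1 (R : realType) (d : Order.disp_t) (V : finOrderType d) (n : nat)
    (D D' : deck V n) : R :=
  n%:R / (2 * #|reorderings D|%:R) *
  \sum_(u in codom D) \sum_(v in codom D | (u < v)%O)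
    (W D u v * Z D' u v)%:~R / ((mult D u)%:R * (mult D v)%:R).

(* Main.v *)
(** For a >= 1 the probability of [pi] is 1/n! times the product over i < n of
    1 + (n - 1 - des pi - i) / a, hence equals
    1/n! * (1 + n/2 * (n - 1 - 2 des pi) / a) + O(a^-2).  The factor
    n - 1 - 2 des pi is the sum of the signs of pi(i+1) - pi(i).  When [pi] is
    uniform in T(D, D'), the pair (pi(i), pi(i+1)) is uniform among the pairs of
    positions of D' carrying the values u = D(i), v = D(i+1) if u <> v, so the
    mean sign is Z(D', u, v) / (n_u n_v); it is 0 by symmetry if u = v.
    Summing over i and using that Z is antisymmetric gives c_1, since
    |T(D, D')| = n! / N. *)
Require Import Defs.
From mathcomp Require Import all_boot all_order all_algebra all_fingroup.
From mathcomp Require Import all_classical all_reals all_analysis.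
From mathcomp Require Import ring.
Import Order.TTheory GRing.Theory Num.Theory.
Import numFieldNormedType.Exports.
Local Open Scope classical_set_scope.
Local Open Scope ring_scope.

(** * First-order expansion of a single shuffle probability *)

(** Subtraction takes place in the ring; for [k > m] the factor [i = m] vanishes, in agreement with
    [m ^_ k = 0]. *)
Lemma natr_ffact (R : pzRingType) (m k : nat) :
  (m ^_ k)%:R = \prod_(i < k) (m%:R - i%:R) :> R.
Proof.
elim: k => [|k IHk]; first by rewrite ffactn0 big_ord0.
rewrite ffactnSr natrM big_ord_recr /= -IHk.
have [le_km|lt_mk] := leqP k m; first by rewrite natrB.
by rewrite ffact_small // !mul0r.
Qed.

Lemma prod_1DM_first_order (R : realFieldType) (k : nat) (c : nat -> R) :
  exists2 C : R, 0 <= C & forall x, 0 <= x <= 1 ->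
    `|\prod_(i < k) (1 + c i * x) - (1 + (\sum_(i < k) c i) * x)|
      <= C * x ^+ 2.
Proof.
elim: k => [|k [C C0 IHk]].
  by exists 0 => // x _; rewrite !big_ord0 !mul0r addr0 subrr normr0.
set s := \sum_(i < k) c i in IHk.
(* The old error gets multiplied by [1 + c k * x], of absolute value at most [1 + |c k|] as
   [x <= 1]; the cross term [s * c k * x ^+ 2] is new. *)
exists (C * (1 + `|c k|) + `|s * c k|) => [|x /andP[x0 x1]].
  by rewrite addr_ge0 // mulr_ge0 // addr_ge0.
rewrite !big_ord_recr /= -/s; set P := \prod_(i < k) _ in IHk *.
have -> : P * (1 + c k * x) - (1 + (s + c k) * x) =
  (P - (1 + s * x)) * (1 + c k * x) + s * c k * x ^+ 2 by ring.
apply: le_trans (ler_normD _ _) _; rewrite [leRHS]mulrDl.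
apply: lerD; last by rewrite normrM (ger0_norm (exprn_ge0 _ x0)).
rewrite normrM mulrAC; apply: ler_pM; rewrite ?IHk ?x0 //.
apply: le_trans (ler_normD _ _) _; rewrite normr1 lerD2l normrM (ger0_norm x0).
by rewrite ler_piMr.
Qed.

Lemma shuffle_prob_prod (R : realType) (n a : nat) (pi : 'S_n) : (0 < a)%N ->
  shuffle_prob R a pi = n`!%:R^-1 *
    \prod_(i < n) (1 + (n%:R - 1 - (des pi)%:R - i%:R) * a%:R^-1).
Proof.
move=> a_gt0; have a_neq0 : a%:R != 0 :> R by rewrite pnatr_eq0 -lt0n.
have le_des : (des pi <= n)%N.
  by rewrite (leq_trans (max_card _)) // card_ord.
have fact_neq0 : n`!%:R != 0 :> R by rewrite pnatr_eq0 -lt0n fact_gt0.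
have binE : 'C(a + n - des pi - 1, n)%:R =
    n`!%:R^-1 * ((a + n - des pi - 1) ^_ n)%:R :> R.
  by rewrite -bin_ffact natrM mulrC mulfK.
rewrite /shuffle_prob binE natr_ffact -mulrA; congr (_ * _).
rewrite -exprVn -[X in _ ^+ X]card_ord -prodr_const -big_split /=.
apply: eq_bigr => i _.
(* No truncation: [des pi + 1 <= a + n] follows from [des pi <= n] and [1 <= a]. *)
rewrite -subnDA natrB ?natrD; last by rewrite addnC leq_add.
by field.
Qed.

Lemma shuffle_prob_first_order (R : realType) (n : nat) (pi : 'S_n) :
  exists2 C : R, 0 <= C & forall a, (0 < a)%N ->
    `|shuffle_prob R a pi -
      n`!%:R^-1 * (1 + n%:R / 2 * (n%:R - 1 - 2 * (des pi)%:R) * a%:R^-1)|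
      <= C * a%:R ^- 2.
Proof.
have [C C0 leC] := @prod_1DM_first_order R n
  (fun i => n%:R - 1 - (des pi)%:R - i%:R).
exists (n`!%:R^-1 * C) => [|a a_gt0]; first by rewrite mulr_ge0.
(* The coefficient of 1/a in the product is n (n - 1 - des) - n (n - 1) / 2. *)
have sumE : \sum_(i < n) (n%:R - 1 - (des pi)%:R - i%:R) =
    n%:R / 2 * (n%:R - 1 - 2 * (des pi)%:R) :> R.
  have gaussE m : \sum_(i < m) i%:R = m%:R * (m%:R - 1) / 2 :> R.
    elim: m => [|m IHm]; first by rewrite big_ord0 !mul0r.
    by rewrite big_ord_recr /= IHm -natr1; field.
  by rewrite sumrB sumr_const card_ord gaussE -mulr_natl; field.
rewrite shuffle_prob_prod // -mulrBr normrM ger0_norm ?invr_ge0 // -[leRHS]mulrA.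
apply: ler_wpM2l; first by rewrite invr_ge0.
rewrite -sumE -exprVn leC // invr_ge0 ler0n /=.
by rewrite invf_le1 ?ltr0n // ler1n.
Qed.

(** * Counting the permutations that turn one deck into another *)

Section Transitions.
Variables (V : finType) (n : nat).
Implicit Types (D E : deck V n) (s pi : 'S_n).

Lemma permuteM D s pi : permute (s * pi)%g D = permute pi (permute s D).
Proof. by apply/ffunP=> j; rewrite !ffunE invMg permM. Qed.

(** Since [permute pi] is injective on decks, right translation by [pi] carries T(D, E) onto T(D, pi
    E). *)
Lemma mem_transitionsM D E s pi :
  ((s * pi)%g \in transitions D (permute pi E)) = (s \in transitions D E).
Proof.
rewrite !inE permuteM; apply/eqP/eqP => [eqE|-> //].
by apply/ffunP=> j; move/ffunP/(_ (pi j)): eqE; rewrite !ffunE permK.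
Qed.

Lemma card_transitionsM D E pi :
  #|transitions D (permute pi E)| = #|transitions D E|.
Proof.
rewrite -!sum1_card (reindex_inj (mulIg pi)) /=.
by apply: eq_bigl => s; rewrite mem_transitionsM.
Qed.

(** S_n is partitioned by the resulting deck, and by translation every fibre has the size of T(D,
    D). *)
Lemma card_transitions D E : E \in reorderings D ->
  (#|reorderings D| * #|transitions D E|)%N = n`!.
Proof.
case/imsetP=> s _ ->; rewrite -card_Sn -[RHS]sum1_card.
rewrite (partition_big (fun pi => permute pi D) (mem (reorderings D))) /=;
  last by move=> pi _; apply: imset_f.
rewrite -sum_nat_const; apply: eq_bigr => _ /imsetP[t _ ->].
rewrite sum1dep_card !card_transitionsM.
by rewrite -(card_transitionsM D D t); apply: eq_card => pi; rewrite !inE.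
Qed.

Lemma mult_permute D pi : mult (permute pi D) =1 mult D.
Proof.
move=> v; rewrite /mult -!sum1_card (reindex_inj (@perm_inj _ pi)) /=.
by apply: eq_bigl => i; rewrite !inE ffunE permK.
Qed.

(** Right translation by a permutation [s] that preserves [E] and sends [p] to [p'] and [q] to [q']
    matches the two sets. Two transpositions give [s]; they do not interfere because
    [E p != E q]. *)
Lemma card_transitions2_eq D E i j p q p' q' :
  E p = E p' -> E q = E q' -> E p != E q ->
  #|[set pi in transitions D E | (pi i == p) && (pi j == q)]| =
  #|[set pi in transitions D E | (pi i == p') && (pi j == q')]|.
Proof.
move=> eqp eqq neq.
have neq_val x y : E x != E y -> (x == y) = false.
  by apply: contra_neqF => /eqP->.
pose s := (tperm p p' * tperm q q')%g.
have sp : s p = p'.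
  by rewrite permM tpermL tpermD // eq_sym neq_val -?eqp -?eqq.
have sq : s q = q'.
  by rewrite permM (@tpermD _ p) ?neq_val -?eqp // tpermL.
have sE : permute s E = E.
  have tpermE x y z : E x = E y -> E (tperm x y z) = E z.
    by case: tpermP => // ->.
  by apply/permuteP=> x; rewrite permM !tpermE.
rewrite -!sum1dep_card [RHS](reindex_inj (mulIg s)) /=.
apply: eq_bigl => t; rewrite -sp -sq !permM.
by rewrite !(inj_eq perm_inj) -{2}sE mem_transitionsM.
Qed.

(** All pairs [(p, q)] of positions with the right values are hit equally often by [(pi i, pi j)],
    so the sum is |T(D, E)| times the mean of [F] over these pairs. *)
Lemma sum_transitions2 (R : numFieldType) D E i j (F : 'I_n -> 'I_n -> R) :
    E \in reorderings D -> D i != D j ->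
  \sum_(pi in transitions D E) F (pi i) (pi j) =
    #|transitions D E|%:R / ((mult D (D i))%:R * (mult D (D j))%:R) *
    \sum_(p | E p == D i) \sum_(q | E q == D j) F p q.
Proof.
move=> ED neq.
pose M p q := #|[set pi in transitions D E | (pi i == p) && (pi j == q)]|.
have sumE (F' : 'I_n -> 'I_n -> R) :
    \sum_(pi in transitions D E) F' (pi i) (pi j) =
    \sum_(p | E p == D i) \sum_(q | E q == D j) (M p q)%:R * F' p q.
  rewrite pair_big /= (partition_big (fun pi : 'S_n => (pi i, pi j))
    (fun x => (E x.1 == D i) && (E x.2 == D j))) /=; last first.
    by move=> pi; rewrite inE => /eqP /permuteP eqE; rewrite !eqE !eqxx.
  apply: eq_bigr => -[p q] _ /=; rewrite mulr_natl -sumr_const.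
  apply: eq_big => [pi|pi]; first by rewrite !inE xpair_eqE.
  by case/andP=> _ /eqP[-> ->].
have multE v : mult E v = mult D v.
  by case/imsetP: ED => s _ ->; apply: mult_permute.
have sum_mult v (x : R) : \sum_(p | E p == v) x = (mult D v)%:R * x.
  rewrite -multE mulr_natl -sumr_const; apply: eq_bigl => p.
  by rewrite inE.
(* The constant function 1 in [sumE] determines the common value of [M]. *)
have cardE p q : E p == D i -> E q == D j ->
    #|transitions D E|%:R = (mult D (D i))%:R * (mult D (D j))%:R * (M p q)%:R
      :> R.
  move=> /eqP Ep /eqP Eq; rewrite -sumr_const (sumE (fun _ _ => 1)).
  rewrite (eq_bigr (fun=> (mult D (D j))%:R * (M p q)%:R)).
    by rewrite sum_mult mulrA.
  move=> p' /eqP Ep'; rewrite (eq_bigr (fun=> (M p q)%:R)).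
    by rewrite sum_mult.
  move=> q' /eqP Eq'; rewrite mulr1; congr _%:R.
  by apply: card_transitions2_eq; rewrite ?Ep' ?Eq' ?Ep ?Eq.
rewrite sumE mulr_sumr; apply: eq_bigr => p Ep; rewrite mulr_sumr.
apply: eq_bigr => q Eq; congr (_ * _); rewrite (cardE p q) // mulrAC divff.
  by rewrite mul1r.
by rewrite -natrM pnatr_eq0 -lt0n muln_gt0 !card_gt0;
  apply/andP; split; apply/set0Pn; [exists i|exists j]; rewrite inE.
Qed.

(** The transposition of [i] and [j] fixes [D]; applying it before [pi] permutes T(D, E) and swaps
    [pi i] with [pi j], so the sum equals its opposite. *)
Lemma sum_transitions2_same (R : numDomainType) D E i j
    (F : 'I_n -> 'I_n -> R) :
    D i = D j -> (forall p q, F q p = - F p q) ->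
  \sum_(pi in transitions D E) F (pi i) (pi j) = 0.
Proof.
move=> eqD antiF; set S := LHS.
suff SN : S = - S.
  by apply/eqP; rewrite -[_ == 0](mulrn_eq0 _ 2) mulr2n {1}SN addNr.
rewrite {1}/S (reindex_inj (mulgI (tperm i j))) /= -sumrN.
apply: eq_big => [pi|pi _]; last by rewrite !permM tpermL tpermR antiF.
rewrite !inE permuteM; congr (permute _ _ == _); apply/permuteP => x.
by case: tpermP => // ->.
Qed.

(** * Signed pair counts *)

Lemma card_pairs (R : pzSemiRingType) E u v :
  #|pairs E u v|%:R =
    \sum_(p | E p == u) \sum_(q | E q == v) (p < q)%N%:R :> R.
Proof.
rewrite pair_big /= -sum1_card natr_sum big_mkcond [RHS]big_mkcond /=.
by apply: eq_bigr => x _; rewrite inE; case: (_ < _)%N => //=; case: ifP.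
Qed.

(** The summand is the sign of [q - p], the form in which [sum_transitions2] produces [Z]. *)
Lemma intr_Z (R : pzRingType) E u v :
  (Z E u v)%:~R = \sum_(p | E p == u) \sum_(q | E q == v)
    ((p < q)%N%:R - (q < p)%N%:R) :> R.
Proof.
rewrite /Z intrB -!pmulrn !card_pairs [X in _ - X]exchange_big /= -sumrB.
by apply: eq_bigr => p _; rewrite sumrB.
Qed.

(** For a reordering [E] of [D] and [D i = u], [D j = v] with [u != v], this is the mean sign of
    [pi j - pi i] over T(D, E). *)
Definition scaled_Z (R : numFieldType) D E u v : R :=
  (Z E u v)%:~R / ((mult D u)%:R * (mult D v)%:R).

Lemma scaled_ZC (R : numFieldType) D E u v :
  scaled_Z R D E v u = - scaled_Z R D E u v.
Proof.
by rewrite /scaled_Z /Z -mulNr -mulrNz opprB [(mult D v)%:R * _]mulrC.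
Qed.

Lemma scaled_Z_diag (R : numFieldType) D E u : scaled_Z R D E u u = 0.
Proof. by rewrite /scaled_Z /Z subrr mul0r. Qed.

(** * Sums over adjacent positions: descents and digraphs *)

(** Adjacency is encoded by an inner sum with at most one term, empty at the last position. *)
Lemma sum_adjacent (R : pzSemiRingType) (x : R) :
  \sum_(i < n) \sum_(j < n | val j == (val i).+1) x = x *+ n.-1.
Proof.
under eq_bigr do rewrite (big_ord1_eq _ (fun=> x)).
case: n => [|m]; first by rewrite big_ord0.
rewrite big_ord_recr /= ltnn addr0 -[m in RHS]card_ord -sumr_const.
by apply: eq_bigr => i _; rewrite ltnS ltn_ord.
Qed.

(** At most one ordinal has value [k]. This turns the existentials in [des] and [digraphs] into sums
    over adjacent positions. *)
Lemma natr_exists_ord (R : pzSemiRingType) (k : nat) (Q : pred 'I_n) :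
  [exists j : 'I_n, (val j == k) && Q j]%:R =
    \sum_(j < n | val j == k) (Q j)%:R :> R.
Proof.
have [lt_kn|le_nk] := ltnP k n.
  rewrite (big_pred1 (Ordinal lt_kn)) => [|j //]; congr (_%:R).
  congr nat_of_bool; apply/existsP/idP => [[j /andP[/eqP jk]]|Qk].
    by congr Q; apply: val_inj.
  by exists (Ordinal lt_kn); rewrite eqxx.
rewrite big_pred0 => [|j]; last first.
  by apply: contraTF (ltn_ord j) => /eqP ->; rewrite -leqNgt.
case: existsP => // -[j /andP[/eqP jk _]].
by move: (ltn_ord j); rewrite -[nat_of_ord j]/(val j) jk ltnNge le_nk.
Qed.

Lemma sum_des (R : numFieldType) D E : (0 < n)%N -> E \in reorderings D ->
  \sum_(pi in transitions D E) (n%:R - 1 - 2 * (des pi)%:R) =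
  #|transitions D E|%:R *
    \sum_(i < n) \sum_(j < n | val j == (val i).+1)
      scaled_Z R D E (D i) (D j).
Proof.
move=> n_gt0 ED.
pose sg (p q : 'I_n) : R := (p < q)%N%:R - (q < p)%N%:R.
(* Among the n - 1 adjacent pairs an ascent contributes 1 and a descent -1. *)
have desE (pi : 'S_n) : n%:R - 1 - 2 * (des pi)%:R =
    \sum_(i < n) \sum_(j < n | val j == (val i).+1) sg (pi i) (pi j).
  have -> : (des pi)%:R = \sum_(i < n) \sum_(j < n | val j == (val i).+1)
      (pi j < pi i)%N%:R :> R.
    rewrite /des -sum1_card natr_sum big_mkcond; apply: eq_bigr => i _.
    by rewrite -natr_exists_ord inE; case: ifP.
  (* Positivity of [n] identifies [n%:R - 1] with the image of [n.-1]. *)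
  rewrite -[n in n%:R](prednK n_gt0) -natr1 addrK -sum_adjacent.
  rewrite mulr_sumr -sumrB.
  apply: eq_bigr => i _; rewrite mulr_sumr -sumrB.
  apply: eq_bigr => j ltij; rewrite /sg.
  (* Equal images are excluded by injectivity of [pi], as [j] is the successor of [i]. *)
  case: ltngtP => [_|_|/val_inj/perm_inj eqij]; [|by rewrite mulr0 subr0|].
    by rewrite mulr1 opprD addNKr sub0r.
  by move: ltij; rewrite eqij eqn_leq ltnn andbF.
rewrite (eq_bigr _ (fun pi _ => desE pi)) exchange_big mulr_sumr /=.
apply: eq_bigr => i _; rewrite exchange_big mulr_sumr /=.
apply: eq_bigr => j ltij.
have [eqD|neqD] := eqVneq (D i) (D j).
  rewrite eqD scaled_Z_diag mulr0 sum_transitions2_same // => p q.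
  by rewrite opprB.
by rewrite sum_transitions2 // -intr_Z /scaled_Z mulrAC mulrA.
Qed.

(** Adjacent positions are grouped by their values: with the digraph counts expanded in indicators,
    only [u = D i], [v = D j] survives. *)
Lemma sum_digraphs (R : pzSemiRingType) D (F : V -> V -> R) :
  \sum_(i < n) \sum_(j < n | val j == (val i).+1) F (D i) (D j) =
  \sum_u \sum_v #|digraphs D u v|%:R * F u v.
Proof.
have digraphsE u v : #|digraphs D u v|%:R = \sum_(i < n)
    \sum_(j < n | val j == (val i).+1) (D i == u)%:R * (D j == v)%:R :> R.
  rewrite -sum1_card natr_sum big_mkcond; apply: eq_bigr => i _.
  by rewrite -mulr_sumr -natr_exists_ord -natrM mulnb inE; case: ifP.
under [RHS]eq_bigr => u _.
  under eq_bigr do rewrite digraphsE mulr_suml.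
  rewrite exchange_big /=; over.
rewrite [RHS]exchange_big; apply: eq_bigr => i _ /=.
under [RHS]eq_bigr => u _.
  under eq_bigr do rewrite mulr_suml.
  rewrite exchange_big /=; over.
rewrite [RHS]exchange_big; apply: eq_bigr => j _ /=.
rewrite (bigD1 (D i)) //= (bigD1 (D j)) //= !eqxx !mul1r.
rewrite !big1 ?addr0 // => [u /negPf neq|v /negPf neq].
  by rewrite big1 // => v _; rewrite eq_sym neq !mul0r.
by rewrite [D j == v]eq_sym neq mulr0 mul0r.
Qed.

Lemma digraphs_notin_codom D u v :
  (u \notin codom D) || (v \notin codom D) -> digraphs D u v = finset.set0.
Proof.
apply: contraTeq => /set0Pn[i].
rewrite inE => /andP[/eqP <- /existsP[j /andP[_ /eqP <-]]].
by rewrite !codom_f.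
Qed.

End Transitions.

Arguments scaled_Z {V n}.

(** * Identification of the coefficient and the final estimate *)

(** Antisymmetry of [Z] splits each term for [u < v] into one contribution of [(u, v)] and one of
    [(v, u)], which leads to a sum over all ordered pairs of values. *)
Lemma c1E (R : realType) (d : Order.disp_t) (V : finOrderType d) (n : nat)
    (D E : deck V n) :
  c1 R D E = n%:R / (2 * #|reorderings D|%:R) *
    \sum_(i < n) \sum_(j < n | val j == (val i).+1)
      scaled_Z R D E (D i) (D j).
Proof.
rewrite sum_digraphs; congr (_ * _).
pose X u v := #|digraphs D u v|%:R * scaled_Z R D E u v.
have termE u v : (W D u v * Z E u v)%:~R / ((mult D u)%:R * (mult D v)%:R) =
    X u v + X v u.
  rewrite /X [scaled_Z _ _ _ v u]scaled_ZC /scaled_Z /W.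
  by rewrite intrM intrB -!pmulrn; ring.
(* Values absent from [D] form no digraph, so the sums may range over all of [V]. *)
have X0 u v : (u \notin codom D) || (v \notin codom D) -> X u v = 0.
  by move=> notin; rewrite /X digraphs_notin_codom // cards0 mul0r.
transitivity (\sum_u \sum_(v | (u < v)%O) (X u v + X v u)).
  rewrite big_mkcond; apply: eq_bigr => u _; case: ifPn => [_|nu]; last first.
    by rewrite big1 // => v _; rewrite !X0 ?addr0 // nu ?orbT.
  rewrite big_mkcondl; apply: eq_bigr => v _; case: ifPn => [_|nv].
    exact: termE.
  by rewrite !X0 ?addr0 // nv ?orbT.
under eq_bigr do rewrite big_split.
(* Exchanging the sums turns the second half into the terms with [v < u]; the diagonal terms are
   0. *)
rewrite big_split /= [X in _ + X](exchange_big_dep xpredT) //= -big_split /=.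
apply: eq_bigr => u _; rewrite [RHS](bigID (fun v => (u < v)%O)) /=.
congr (_ + _); rewrite [LHS]big_mkcond [RHS]big_mkcond; apply: eq_bigr => v _.
by case: (ltgtP u v) => //= ->; rewrite /X scaled_Z_diag mulr0.
Qed.

Theorem theorem1 (R : realType) (d : Order.disp_t) (V : finOrderType d)
    (n : nat) (hn : (0 < n)%N) (D D' : deck V n)
    (hD' : D' \in reorderings D) :
  (fun a : nat => trans_prob R a D D' : R^o) =
  (fun a : nat => #|reorderings D|%:R^-1 + c1 R D D' * a%:R^-1 : R^o)
  +O_\oo (fun a : nat => a%:R ^- 2 : R^o).
Proof.
have [C C0 leC] : exists2 C : R, 0 <= C & forall a, (0 < a)%N ->
    `|trans_prob R a D D' - (#|reorderings D|%:R^-1 + c1 R D D' * a%:R^-1)|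
      <= C * a%:R ^- 2.
  (* One constant is chosen per permutation; their sum over T(D, D') bounds the total error. *)
  pose P (pi : 'S_n) (C : R) := 0 <= C /\ forall a, (0 < a)%N ->
    `|shuffle_prob R a pi -
      n`!%:R^-1 * (1 + n%:R / 2 * (n%:R - 1 - 2 * (des pi)%:R) * a%:R^-1)|
      <= C * a%:R ^- 2.
  have /choice[C CP] (pi : 'S_n) : exists C, P pi C.
    by have [C C0 leC] := @shuffle_prob_first_order R n pi; exists C.
  exists (\sum_(pi in transitions D D') C pi) => [|a a_gt0].
    by apply: sumr_ge0 => pi _; case: (CP pi).
  have N0 : #|reorderings D|%:R != 0 :> R.
    by rewrite pnatr_eq0 -lt0n card_gt0; apply/set0Pn; exists D'.
  have T0 : #|transitions D D'|%:R != 0 :> R.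
    by rewrite pnatr_eq0 -lt0n -(@ltn_pmul2l #|reorderings D|) ?muln0
      ?card_transitions ?fact_gt0 // lt0n -(pnatr_eq0 R).
  (* The first-order terms add up exactly to the claimed expansion, by [sum_des] and n! = N |T(D,
     D')|. *)
  have -> : #|reorderings D|%:R^-1 + c1 R D D' * a%:R^-1 =
      \sum_(pi in transitions D D') n`!%:R^-1 *
        (1 + n%:R / 2 * (n%:R - 1 - 2 * (des pi)%:R) * a%:R^-1).
    rewrite -mulr_sumr big_split /= sumr_const -mulr_suml -mulr_sumr.
    rewrite sum_des // c1E -(card_transitions _ _ _ _ hD') natrM.
    by field; rewrite N0 T0 pnatr_eq0 -lt0n a_gt0.
  rewrite /trans_prob -sumrB mulr_suml.
  apply: le_trans (ler_norm_sum _ _ _) _; apply: ler_sum => pi _.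
  by case: (CP pi) => _; apply.
(* The constant [k] is near +oo, hence may be taken above [C]; [a] is large, hence positive. *)
apply/eqaddOP; near=> k; near=> a.
have a_gt0 : (0 < a)%N by near: a; exact: nbhs_infty_gt.
apply: le_trans (leC a a_gt0) _.
rewrite ger0_norm ?invr_ge0 ?exprn_ge0 // ler_wpM2r ?invr_ge0 ?exprn_ge0 //.
Unshelve. all: by end_near.
Qed.
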